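(* Let $A$ and $B$ denote the adjacency matrices of a $(v,k)$-strongly regular graph and its complement, respectively, and let $-\beta<0$ and $m$ denote the smallest eigenvalue of $A$ and its multiplicity, respectively. Suppose $2k+1\ne v<2(k+\beta)$. Put $d=v-m$ and $\mu=1/(2\beta-1)$. Then $I+\mu A-\mu B$ is the Gram matrix of a strongly locally optimal $v$-packing in $\mathbb{R}\mathbf{P}^{d-1}$.
   Context: A $(v,k)$-strongly regular graph is a $k$-regular simple graph on $v$ vertices for which there are constants $a,c$ such that any two distinct adjacent vertices have exactly $a$ common neighbors and any two distinct non-adjacent vertices have exactly $c$ common neighbors. An $n$-packing in $\mathbb{R}\mathbf{P}^{d-1}$ is a sequence of $n$ unit vectors in $\mathbb{R}^d$, identified with the $d\times n$ matrix $\Phi$ having these vectors as columns; its Gram matrix is $\Phi^\top\Phi$. Let \[ \mathcal{M}_d^n=\{G\in\mathbb{R}^{n\times n}: G^\top=G,\ \operatorname{diag}(G)=\mathbf{1},\ G\succeq0,\ \operatorname{rank}(G)=d\}, \] which is the set of Gram matrices of spanning $n$-packings in $\mathbb{R}\mathbf{P}^{d-1}$, and let $\|\cdot\|_\infty$ be the entrywise max norm. An $n$-packing in $\mathbb{R}\mathbf{P}^{d-1}$ with Gram matrix $G$ is strongly locally optimal if $G\in\mathcal{M}_d^n$ and $G$ is a strong local minimizer of $X\mapsto\|X-I\|_\infty$ over $\mathcal{M}_d^n$, i.e., there is a neighborhood $\mathcal{N}$ of $G$ in $\mathbb{R}^{n\times n}$ such that $\|X-I\|_\infty>\|G-I\|_\infty$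 for every $X\in\mathcal{M}_d^n\cap\mathcal{N}\setminus\{G\}$. *)

(* Defs.v *)
From HB Require Import structures.
From mathcomp Require Export all_boot all_order all_algebra.
From mathcomp Require Export boolp classical_sets reals topology normedtype.

Set Implicit Arguments.
Unset Strict Implicit.
Unset Printing Implicit Defensive.

Import Order.TTheory GRing.Theory Num.Theory.
Import numFieldNormedType.Exports.

Local Open Scope ring_scope.

(* A graph on n labelled vertices is given by its adjacency relation on 'I_n. *)
Definition simple_graph (n : nat) (e : rel 'I_n) : Prop :=
  symmetric e /\ irreflexive e.

Definition regular_graph (n k : nat) (e : rel 'I_n) : Prop :=
  forall x : 'I_n, #|[set y | e x y]| = k.

Definition common_neighbors (n : nat) (e : rel 'I_n) (x y : 'I_n) :
  {set 'I_n} := [set z | e x z && e y z].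

(* Complete and edgeless graphs are not excluded; for them one of the two
   constants is unconstrained. *)
Definition strongly_regular (v k : nat) (e : rel 'I_v) : Prop :=
  [/\ simple_graph e, regular_graph k e &
      exists a c : nat,
        (forall x y, x != y -> e x y -> #|common_neighbors e x y| = a) /\
        (forall x y, x != y -> ~~ e x y -> #|common_neighbors e x y| = c)].

Definition graph_compl (n : nat) (e : rel 'I_n) : rel 'I_n :=
  [rel x y | (x != y) && ~~ e x y].

Definition adjacency_mx (R : realType) (n : nat) (e : rel 'I_n) : 'M[R]_n :=
  \matrix_(i, j) (e i j)%:R.

Definition smallest_eigenvalue (R : realType) (n : nat) (A : 'M[R]_n) (a : R) :
  Prop :=
  eigenvalue A a /\ (forall b : R, eigenvalue A b -> a <= b).

(* Dimension of the eigenspace; [eigenspace] consists of row vectors, which is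
   immaterial for the symmetric matrices considered here, and for these this is
   also the multiplicity in the characteristic polynomial. *)
Definition eigenvalue_mult (R : realType) (n : nat) (A : 'M[R]_n) (a : R) : nat :=
  \rank (eigenspace A a).

Definition packing (R : realType) (d n : nat) (Phi : 'M[R]_(d, n)) : Prop :=
  forall j : 'I_n, \sum_(i < d) Phi i j ^+ 2 = 1.

Definition gram (R : realType) (d n : nat) (Phi : 'M[R]_(d, n)) : 'M[R]_n :=
  Phi^T *m Phi.

Definition psd (R : realType) (n : nat) (G : 'M[R]_n) : Prop :=
  forall x : 'cV[R]_n, 0 <= (x^T *m G *m x) ord0 ord0.

Local Open Scope classical_set_scope.

Definition gram_set (R : realType) (d n : nat) : set 'M[R]_n :=
  [set G | [/\ G^T = G, forall i, G i i = 1, psd G & \rank G = d]].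

(* The library norm on matrices is the entrywise max norm, and [nbhs] is taken
   in the entrywise topology of R^(n x n). *)
Definition strong_local_minimizer (R : realType) (n : nat)
    (f : 'M[R]_n -> R) (M : set 'M[R]_n) (G : 'M[R]_n) : Prop :=
  M G /\ exists2 N : set 'M[R]_n, nbhs G N &
    forall X, (M `&` N `\ G) X -> f G < f X.

Definition strongly_locally_optimal (R : realType) (d n : nat)
    (Phi : 'M[R]_(d, n)) : Prop :=
  packing Phi /\
  strong_local_minimizer (fun X : 'M[R]_n => `|X - 1%:M|) (@gram_set R d n)
    (gram Phi).

(* Main.v *)
Require Import Defs.
From mathcomp Require Import ring lra.

(** Write s = - beta and J for the all-ones matrix.  Counting walks of length
    two gives A^2 = (k - c) I + (a - c) A + c J; applied to an eigenvector of s,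
    which is orthogonal to the constants, it yields (A - s)(A - r) = c J with
    r = a - c - s.  Hence R^v is the orthogonal sum of the constants, of the
    eigenspace of s, and of a space on which A acts as r, and everything in
    sight lives in the commutative algebra spanned by I, A and J.  In
    particular G = I + mu A - mu B = 2 mu (A - s) - mu J is 0 on the eigenspace
    of s and acts by positive scalars on the other two summands: the assumption
    v < 2 (k + beta) is positivity on the constants.  So G is positive
    semidefinite of rank d and is a Gram matrix (psd_gram_factor).

    Local optimality comes from the orthogonal projector P onto the kernel of G
    (projector_sign_strong_local_minimizer).  Off the diagonal, P is negative
    where G is mu and positive where G is - mu.  If X competes with G then
    H = X - G vanishes on the diagonal, and |X_ij| <= mu forces H_ij <= 0 where
    G_ij = mu and H_ij >= 0 where G_ij = - mu.  Thus all terms of tr (P H) are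
    nonnegative and tr (P H) >= p |H| with p > 0 (trace_projector_linear).  On
    the other hand G has no component in the kernel of G, and a perturbation
    that keeps the rank can create one only at second order:
    tr (P H) = O(|H|^2) (trace_projector_quadratic).  For small H the two
    estimates force H = 0.

    The signs of P = (r + beta)^-1 (r I - A + ((k - r) / v) J) are where the
    combinatorics enters (srg_eigenvalue).  On edges one needs k - r < v.  On
    non-adjacent pairs one needs r < k; this fails only for disjoint unions of
    complete graphs, which have beta = 1, and v < 2 (k + beta) then leaves no
    room for a second component. *)

Set Implicit Arguments.
Unset Strict Implicit.
Unset Printing Implicit Defensive.

Import Order.TTheory GRing.Theory Num.Theory.
Import numFieldNormedType.Exports.

Local Open Scope ring_scope.

(** * The entrywise maximum norm *)

Lemma mx_entry_le_norm (R : realType) (m n : nat) (A : 'M[R]_(m, n)) i j :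
  `|A i j| <= `|A|.
Proof.
rewrite [leRHS]mx_normrE.
exact: (le_bigmax _ (fun ij : 'I_m * 'I_n => `|A ij.1 ij.2|) (i, j)).
Qed.

Lemma mx_norm_le (R : realType) (m n : nat) (A : 'M[R]_(m, n)) (c : R) :
  0 <= c -> (forall i j, `|A i j| <= c) -> `|A| <= c.
Proof.
by move=> c0 Ac; rewrite [leLHS]mx_normrE; apply: bigmax_le => // -[i j] _.
Qed.

Lemma mx_norm_mul (R : realType) (m n p : nat) (A : 'M[R]_(m, n))
    (B : 'M[R]_(n, p)) : `|A *m B| <= n%:R * (`|A| * `|B|).
Proof.
apply: mx_norm_le => [|i j]; first by rewrite !mulr_ge0.
rewrite mxE; apply: le_trans (ler_norm_sum _ _ _) _.
apply: (@le_trans _ _ (\sum_(k < n) `|A| * `|B|)).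
  by apply: ler_sum => k _; rewrite normrM ler_pM ?mx_entry_le_norm.
by rewrite sumr_const card_ord mulr_natl.
Qed.

Lemma norm_mxtrace (R : realType) (n : nat) (A : 'M[R]_n) :
  `|\tr A| <= n%:R * `|A|.
Proof.
rewrite /mxtrace; apply: le_trans (ler_norm_sum _ _ _) _.
apply: (@le_trans _ _ (\sum_(i < n) `|A|)).
  by apply: ler_sum => i _; exact: mx_entry_le_norm.
by rewrite sumr_const card_ord mulr_natl.
Qed.

(** * Kernels and complementary projectors *)

Section Kernel.
Variables (F : fieldType) (n : nat).
Implicit Types G P X : 'M[F]_n.

Lemma kermx_sub_projector G P :
  P *m G = 0 -> (\rank P + \rank G = n)%N -> (kermx G <= P)%MS.
Proof.
move=> PG rk; have sPK : (P <= kermx G)%MS by apply/sub_kermxP.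
by rewrite -(mxrank_leqif_sup sPK) mxrank_ker -(addnK (\rank G) (\rank P)) rk.
Qed.

(** P is invertible on the kernel of G, where G vanishes, and G is injective on
    the kernel of P. *)
Lemma add_projector_unitmx G P :
  P *m P = P -> P *m G = 0 -> G *m P = 0 -> (\rank P + \rank G = n)%N ->
  G + P \in unitmx.
Proof.
move=> PP PG GP rk; rewrite -row_free_unit -kermx_eq0.
set K := kermx _; have K0 : K *m (G + P) = 0 by exact: mulmx_ker.
have KP : K *m P = 0.
  by rewrite -(mul0mx n P) -K0 -mulmxA mulmxDl GP PP add0r.
have KG : K *m G = 0 by move: K0; rewrite mulmxDr KP addr0.
have /submxP[D KE] : (K <= P)%MS.
  by apply: submx_trans (kermx_sub_projector PG rk); apply/sub_kermxP.
by rewrite KE -PP mulmxA -KE KP.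
Qed.

(** X + P and P agree on the row kernel of X, whose dimension is the rank of P;
    as X + P is invertible, that kernel is mapped onto the row space of P.  The
    rows of L are the preimages of the rows of P. *)
Lemma ker_preimage_projector X P :
  X + P \in unitmx -> (\rank P + \rank X = n)%N ->
  exists2 L : 'M[F]_n, L *m X = 0 & L *m P = P.
Proof.
move=> U rk; set K := kermx X; have KX : K *m X = 0 by exact: mulmx_ker.
have KXP : K *m (X + P) = K *m P by rewrite mulmxDr KX add0r.
have sKP : (K *m P <= P)%MS by exact: submxMl.
have : (P <= K *m P)%MS.
  rewrite -(mxrank_leqif_sup sKP) -KXP mxrankMfree ?row_free_unit //.
  by rewrite mxrank_ker -(addnK (\rank X) (\rank P)) rk.
case/submxP=> D PE; exists (D *m K); first by rewrite -mulmxA KX mulmx0.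
by rewrite -mulmxA -PE.
Qed.

End Kernel.

(** * Rank-preserving perturbations *)

Section Perturbation.
Variables (R : realType) (n : nat).
Implicit Types G P X : 'M[R]_n.

(** Let H = X - G and N = (G + P)^-1, so that P N = P.  Near G the matrix X + P
    is still invertible, so equality of ranks provides L with L X = 0 and
    L P = P.  Then L (G + P) = P - L H gives L = P - L H N.  Since X P = H P,
    also L H P = 0, and therefore P H P = L H N H P is quadratic in H; its trace
    is that of P H.  The formula for L bounds |L| by 2 |P|. *)
Lemma trace_projector_quadratic G P :
    P *m P = P -> P *m G = 0 -> G *m P = 0 -> (\rank P + \rank G = n)%N ->
  exists2 eps : R, 0 < eps & exists2 C : R, 0 < C &
    forall X, `|X - G| < eps -> \rank X = \rank G ->
      `|\tr (P *m (X - G))| <= C * `|X - G| ^+ 2.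
Proof.
move=> PP PG GP rk; have U := add_projector_unitmx PP PG GP rk.
set N := invmx (G + P).
have PN : P *m N = P.
  have PGP : P *m (G + P) = P by rewrite mulmxDr PG PP add0r.
  by rewrite -[in LHS]PGP mulmxK.
pose a := n%:R * (n%:R * `|N|) : R.
have a0 : 0 <= a by rewrite !mulr_ge0.
(* Right multiplication by (X - G) *m N halves the norm on the eps-ball. *)
have half m (Z : 'M[R]_(m, n)) (H : 'M[R]_n) :
    `|H| < (2 * (1 + a))^-1 -> `|Z *m H *m N| <= `|Z| / 2.
  move=> Hs; apply: le_trans (mx_norm_mul _ _) _.
  have b0 : 0 <= n%:R * `|N| :> R by rewrite mulr_ge0.
  have z0 : 0 <= `|Z| by [].
  have /(ler_wpM2r b0) := mx_norm_mul Z H.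
  have : 2 * (1 + a) * `|H| <= 1.
    by rewrite mulrC -ler_pdivlMr ?div1r ?ltW //; lra.
  have h0 : 0 <= `|H| by [].
  move=> h1 h2; rewrite [leLHS](_ : _ = n%:R * `|N| * `|Z *m H|); last ring.
  rewrite mulrC; apply: le_trans h2 _.
  rewrite [leLHS](_ : _ = `|Z| * (a * `|H|)); last by rewrite /a; ring.
  by apply: ler_wpM2l => //; lra.
exists (2 * (1 + a))^-1; first by rewrite invr_gt0; lra.
(* The constant collects the bounds for the norm of L *m H *m N *m H *m P; the
   summand 1 only makes it positive. *)
exists (1 + n%:R * (n%:R * (n%:R * (n%:R * (n%:R * (2 * `|P|) * `|N|)) * `|P|))).
  by rewrite ltr_pwDl // !mulr_ge0.
move=> X Xs rX; set H := X - G in Xs *.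
have XE : X = G + H by rewrite /H addrC subrK.
have UX : X + P \in unitmx.
  rewrite -row_free_unit -kermx_eq0; set K := kermx _.
  have K0 : K *m (X + P) = 0 by exact: mulmx_ker.
  (* A row kernel K of X + P satisfies K = - K H N, so its norm is at most half
     of itself. *)
  have KE : K = - (K *m H *m N).
    rewrite -[LHS](mulmxK U) -/N -mulNmx; congr (_ *m N).
    by apply/eqP; rewrite -addr_eq0 -mulmxDr addrAC -XE K0.
  have := half _ K H Xs; rewrite -normrN -KE => hK.
  by rewrite -normr_le0; lra.
have [L LX LP] := ker_preimage_projector UX (eq_trans (congr1 _ rX) rk).
have LE : L = P - L *m H *m N.
  have : L *m (G + P) = P - L *m H.
    have := LX; rewrite XE !mulmxDr LP => /eqP; rewrite addr_eq0 => /eqP ->.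
    by rewrite addrC.
  by move/(congr1 (mulmx^~ N)); rewrite mulmxK // mulmxBl PN.
have Ls : `|L| <= 2 * `|P|.
  have := half _ L H Xs; have : `|L| <= `|P| + `|L *m H *m N|.
    by rewrite [in leLHS]LE ler_normB.
  by lra.
have PHP : P *m H *m P = L *m H *m N *m H *m P.
  have PE : P = L + L *m H *m N by rewrite [in X in X + _]LE subrK.
  have LHP : L *m H *m P = 0.
    by rewrite /H mulmxBr mulmxBl LX mul0mx sub0r -mulmxA GP mulmx0 oppr0.
  by rewrite [in X in X *m H]PE mulmxDl mulmxDl LHP add0r.
have -> : \tr (P *m H) = \tr (P *m H *m P).
  by rewrite [RHS]mxtrace_mulC mulmxA PP.
rewrite PHP; apply: le_trans (norm_mxtrace _) _.
have nn : 0 <= n%:R :> R by [].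
have e1 : `|L *m H| <= n%:R * (2 * `|P|) * `|H|.
  by apply: le_trans (mx_norm_mul _ _) _; rewrite -mulrA ler_wpM2l // ler_wpM2r.
have e2 : `|L *m H *m N| <= n%:R * (n%:R * (2 * `|P|) * `|N|) * `|H|.
  apply: le_trans (mx_norm_mul _ _) _; rewrite -mulrA ler_wpM2l //.
  by rewrite [leRHS]mulrAC ler_wpM2r.
have e3 : `|L *m H *m N *m H| <=
    n%:R * (n%:R * (n%:R * (2 * `|P|) * `|N|)) * `|H| ^+ 2.
  apply: le_trans (mx_norm_mul _ _) _; rewrite -mulrA ler_wpM2l //.
  by rewrite expr2 mulrA ler_wpM2r.
have e4 : `|L *m H *m N *m H *m P| <=
    n%:R * (n%:R * (n%:R * (n%:R * (2 * `|P|) * `|N|)) * `|P|) * `|H| ^+ 2.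
  apply: le_trans (mx_norm_mul _ _) _; rewrite -mulrA ler_wpM2l //.
  by rewrite [leRHS]mulrAC ler_wpM2r.
apply: le_trans (ler_wpM2l nn e4) _.
by rewrite [leLHS]mulrA [leRHS]mulrDl lerDr mul1r sqr_ge0.
Qed.

End Perturbation.

(** * A sign criterion for strong local minimizers *)

Lemma exists_pos_lower_bound (R : realType) (I : finType) (Q : pred I)
    (f : I -> R) :
  (forall i, Q i -> 0 < f i) ->
  exists2 p : R, 0 < p & forall i, Q i -> p <= f i.
Proof.
move=> f0; exists (\big[Order.min/1]_(i | Q i) f i).
  exact: lt_bigmin.
by move=> i Qi; exact: bigmin_le_cond.
Qed.

Section Criterion.
Variables (R : realType) (d n : nat) (mu : R) (G P : 'M[R]_n).
Hypothesis G_gram : @gram_set R d n G.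
Hypotheses (P_sym : P^T = P) (P_idem : P *m P = P) (PG : P *m G = 0).
Hypothesis rank_P : (\rank P + d = n)%N.
Hypothesis mu_ge0 : 0 <= mu.
Hypothesis P_sign : forall i j, i != j ->
  G i j = mu /\ P i j < 0 \/ G i j = - mu /\ 0 < P i j.

Lemma norm_gram_sub1 : `|G - 1%:M| <= mu.
Proof.
have [_ G1 _ _] := G_gram; apply: mx_norm_le => // i j; rewrite !mxE.
have [<-|ij] := eqVneq i j; first by rewrite G1 subrr normr0.
by rewrite subr0; case: (P_sign ij) => -[-> _]; rewrite ?normrN ger0_norm.
Qed.

(** The sign of each entry of X - G is forced to be that of the entry of P, so
    the trace dominates each single term, in particular the one where the norm
    of X - G is attained. *)
Lemma trace_projector_linear : exists2 p : R, 0 < p &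
  forall X, gram_set d X -> `|X - 1%:M| <= mu ->
    p * `|X - G| <= \tr (P *m (X - G)).
Proof.
have [_ G1 _ _] := G_gram.
have [|p p0 pP] := @exists_pos_lower_bound R ('I_n * 'I_n)%type
  (fun ij => ij.1 != ij.2) (fun ij => `|P ij.1 ij.2|).
  case=> i j /= ij; rewrite normr_gt0.
  by case: (P_sign ij) => -[_]; [move/ltr0_neq0 | move/lt0r_neq0].
exists p => // X [Xsym X1 _ _] Xmu.
have diag i : (X - G) i i = 0 by rewrite !mxE X1 G1 subrr.
have off i j : i != j -> P j i * (X - G) i j = `|P j i| * `|(X - G) i j|.
  move=> ij; have PE : P j i = P i j by rewrite -{1}P_sym mxE.
  have : `|X i j| <= mu.
    have := le_trans (mx_entry_le_norm (X - 1%:M) i j) Xmu.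
    by rewrite !mxE (negPf ij) subr0.
  rewrite ler_norml !mxE PE => /andP[lo hi].
  case: (P_sign ij) => -[-> sP].
    by rewrite (ltr0_norm sP) ler0_norm ?mulrNN // subr_le0.
  by rewrite (gtr0_norm sP) ger0_norm // opprK -[0](addNr mu) lerD2r.
have ge0 i j : 0 <= P j i * (X - G) i j.
  have [<-|ij] := eqVneq i j; first by rewrite diag mulr0.
  by rewrite off // mulr_ge0.
have trE : \tr (P *m (X - G)) = \sum_j \sum_i P j i * (X - G) i j.
  by apply: eq_bigr => j _; rewrite [LHS]mxE.
have tr_ge i j : P j i * (X - G) i j <= \tr (P *m (X - G)).
  rewrite trE (bigD1 j) //= (bigD1 i) //= -addrA lerDl addr_ge0 //.
    exact: sumr_ge0.
  by apply: sumr_ge0 => l _; apply: sumr_ge0.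
have [->|H0] := eqVneq `|X - G| 0.
  by rewrite mulr0 trE; apply: sumr_ge0 => i _; apply: sumr_ge0.
have [[i j] /= HE] := mx_norm_neq0 H0.
rewrite [`|X - G|]HE; have [ij|ij] := eqVneq i j.
  by move: H0; rewrite [`|X - G|]HE ij diag normr0 eqxx.
apply: le_trans (tr_ge i j); rewrite off // ler_wpM2r //.
by apply: (pP (j, i)); rewrite eq_sym.
Qed.

(** P is a dual certificate: tr (P H) is at least p |H| and at most C |H|^2,
    which is impossible for 0 < |H| < p / C. *)
Lemma projector_sign_strong_local_minimizer :
  strong_local_minimizer (fun X : 'M[R]_n => `|X - 1%:M|) (@gram_set R d n) G.
Proof.
split=> //; have [Gsym _ _ rG] := G_gram.
have GP : G *m P = 0.
  by rewrite -[LHS]trmxK trmx_mul Gsym P_sym PG trmx0.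
have [eps eps0 [C C0 quad]] := trace_projector_quadratic P_idem PG GP
  (etrans (congr1 _ rG) rank_P).
have [p p0 lin] := trace_projector_linear.
have e0 : 0 < Num.min eps (p / C) by rewrite lt_min eps0 divr_gt0.
exists (ball G (Num.min eps (p / C))); first exact: nbhsx_ballx.
move=> X [[XM]]; rewrite mx_norm_ball /ball_ /= distrC lt_min.
case/andP=> Xeps XpC XG; rewrite ltNge; apply/negP => leXG.
have [_ _ _ rX] := XM.
have h1 := lin X XM (le_trans leXG norm_gram_sub1).
have h2 := quad X Xeps (etrans rX (esym rG)).
have h3 := le_trans h1 (le_trans (ler_norm _) h2).
apply: XG; apply/eqP; rewrite -subr_eq0 -normr_le0 leNgt; apply/negP => H0.
move: h3; rewrite expr2 mulrA ler_pM2r // leNgt => /negP; apply.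
by rewrite mulrC -ltr_pdivlMr.
Qed.

End Criterion.

(** * Gram factorization of positive semidefinite matrices *)

Lemma quad_form_delta (R : realType) (n : nat) (G : 'M[R]_n) i j :
  ((delta_mx i ord0 : 'cV_n)^T *m G *m (delta_mx j ord0 : 'cV_n)) ord0 ord0
  = G i j.
Proof. by rewrite trmx_delta -rowE -colE !mxE. Qed.

(** The form takes the value - 2 t^2 at e_i - t e_j when t = G_ij. *)
Lemma psd_diag0_eq0 (R : realType) (n : nat) (G : 'M[R]_n) :
  G^T = G -> psd G -> (forall i, G i i = 0) -> G = 0.
Proof.
move=> Gsym Gpsd G0; apply/matrixP => i j; rewrite [RHS]mxE; set t := G i j.
have Gji : G j i = t by rewrite -[in LHS]Gsym mxE.
pose ei : 'cV[R]_n := delta_mx i ord0; pose ej : 'cV[R]_n := delta_mx j ord0.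
have entB (X Y : 'M[R]_1) i0 j0 : (X - Y) i0 j0 = X i0 j0 - Y i0 j0.
  by rewrite !mxE.
have entZ (c : R) (X : 'M[R]_1) i0 j0 : (c *: X) i0 j0 = c * X i0 j0.
  by rewrite !mxE.
have := Gpsd (ei - t *: ej).
have -> : (ei - t *: ej)^T = ei^T - t *: ej^T.
  by apply/matrixP => p q; rewrite !mxE.
rewrite !mulmxBl !mulmxBr -!scalemxAl -!scalemxAr !entB !entZ !quad_form_delta.
rewrite !G0 Gji -/t => h.
by apply/eqP; rewrite -sqrf_eq0 eq_le sqr_ge0 expr2 andbT; lra.
Qed.

(** One step of Cholesky elimination: with u = e_i and g = G_ii > 0, subtracting
    g^-1 (G u)(G u)^T produces the congruent matrix T^T G T, where
    T = I - g^-1 u (u^T G).  It is again positive semidefinite, and its rank is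
    smaller because its kernel acquires u. *)
Lemma psd_gram_factor (R : realType) (n r : nat) (G : 'M[R]_n) :
  G^T = G -> psd G -> (\rank G <= r)%N ->
  exists Phi : 'M[R]_(r, n), gram Phi = G.
Proof.
elim: r G => [|r IH] G Gsym Gpsd rG.
  exists 0; move: rG; rewrite leqn0 mxrank_eq0 => /eqP ->.
  by rewrite /gram mulmx0.
have [i Gi|diag0] := pickP (fun i => G i i != 0); last first.
  exists 0; rewrite /gram mulmx0 (psd_diag0_eq0 Gsym Gpsd) // => i.
  exact/eqP/negbFE/diag0.
pose u : 'cV[R]_n := delta_mx i ord0.
have uGu : u^T *m G *m u = (G i i)%:M.
  by rewrite [LHS]mx11_scalar quad_form_delta.
have Gi0 : 0 < G i i.
  by rewrite lt_neqAle eq_sym Gi -(quad_form_delta G i i); apply: Gpsd.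
set g := G i i in Gi uGu Gi0.
pose T := 1%:M - g^-1 *: (u *m (u^T *m G)).
have GT : G *m T = G - g^-1 *: (G *m u *m (u^T *m G)).
  by rewrite mulmxBr mulmx1 -scalemxAr !mulmxA.
have TG : T^T *m G = G *m T.
  by rewrite GT linearB linearZ /= trmx1 !trmx_mul trmxK Gsym mulmxBl mul1mx
             -scalemxAl !mulmxA.
have Tu : T *m u = 0.
  rewrite mulmxBl mul1mx -scalemxAl -mulmxA uGu mul_mx_scalar scalerA.
  by rewrite mulVf // scale1r subrr.
have TGT : T^T *m G *m T = G *m T.
  rewrite TG -mulmxA; congr (_ *m _).
  by rewrite [in X in _ *m X]/T mulmxBr mulmx1 -scalemxAr (mulmxA T) Tu
             mul0mx scaler0 subr0.
have GTsym : (G *m T)^T = G *m T by rewrite trmx_mul Gsym TG.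
have GTpsd : psd (G *m T).
  by move=> x; have := Gpsd (T *m x); rewrite trmx_mul -TGT !mulmxA.
have rGT : (\rank (G *m T) < \rank G)%N.
  apply: rank_ltmx; rewrite ltmxE -TG submxMl TG /=.
  apply/negP => /submxP[D GE]; case/eqP: Gi.
  rewrite -[LHS](quad_form_delta G i i) -/u [X in _ *m X *m _]GE -!mulmxA Tu.
  by rewrite !mulmx0 mxE.
have [Phi PhiE] := IH _ GTsym GTpsd (leq_trans rGT rG).
suff: gram (col_mx ((Num.sqrt g)^-1 *: (u^T *m G)) Phi) = G.
  by eexists; eassumption.
have trZ (c : R) (M : 'M[R]_(1, n)) : (c *: M)^T = c *: M^T by rewrite linearZ.
rewrite /gram tr_col_mx mul_row_col trZ -scalemxAl -scalemxAr scalerA.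
rewrite -invfM -expr2 sqr_sqrtr ?ltW // -/(gram Phi) PhiE GT.
by rewrite trmx_mul trmxK Gsym addrC subrK.
Qed.

(** * The algebra spanned by I, A and J *)

Section AdjacencyAlgebra.
Variables (R : realType) (n : nat) (A : 'M[R]_n) (k r beta : R).
Let J : 'M[R]_n := const_mx 1.
Let N : R := n%:R.
Hypothesis n_gt0 : (0 < n)%N.
Hypotheses (A_sym : A^T = A) (AJ : A *m J = k *: J).
(* This is (A + beta) (A - r) = c J; comparing both sides on the constants
   determines the coefficient c. *)
Hypothesis A_quad : A *m A =
  (r * beta)%:M + (r - beta) *: A + ((k - r) * (k + beta) / N) *: J.
Hypotheses (rb_gt0 : 0 < r + beta) (kb_gt0 : 0 < k + beta).

Definition adj_comb (x y z : R) : 'M[R]_n := x%:M + y *: A + z *: const_mx 1.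

Let N_neq0 : N != 0. Proof. by rewrite pnatr_eq0 -lt0n. Qed.
Let rb_neq0 : r + beta != 0. Proof. by rewrite gt_eqF. Qed.
Let kb_neq0 : k + beta != 0. Proof. by rewrite gt_eqF. Qed.

Lemma const1_mul : J *m J = N *: J.
Proof.
apply/matrixP => i j; rewrite !mxE (eq_bigr (fun=> 1)); last first.
  by move=> l _; rewrite !mxE mulr1.
by rewrite sumr_const card_ord mulr1.
Qed.

Lemma const1_adj : J *m A = k *: J.
Proof.
by rewrite -[LHS]trmxK trmx_mul A_sym trmx_const AJ linearZ /= trmx_const.
Qed.

Lemma adj_comb_mul x y z x' y' z' :
  adj_comb x y z *m adj_comb x' y' z' =
  adj_comb (x * x' + r * beta * (y * y'))
           (x * y' + y * x' + (r - beta) * (y * y'))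
           (x * z' + z * x' + k * (y * z' + z * y') + N * (z * z')
            + (k - r) * (k + beta) / N * (y * y')).
Proof.
rewrite /adj_comb !mulmxDl !mulmxDr -!scalemxAl -!scalemxAr.
rewrite !mul_scalar_mx !mul_mx_scalar AJ A_quad const1_adj const1_mul.
by apply/matrixP => i j; rewrite !mxE; case: (i == j) => /=; ring.
Qed.

Lemma adj_comb_sym x y z : (adj_comb x y z)^T = adj_comb x y z.
Proof.
by rewrite /adj_comb !linearD !linearZ /= tr_scalar_mx trmx_const A_sym.
Qed.

Lemma adj_comb0 : adj_comb 0 0 0 = 0.
Proof. by rewrite /adj_comb !scale0r !addr0 -scalemx1 scale0r. Qed.

(** The Lagrange interpolant (r - A) / (r + beta), which is 1 at the eigenvalue
    - beta and 0 at r, corrected by a multiple of J to vanish on constants. *)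
Definition least_proj : 'M[R]_n :=
  adj_comb (r / (r + beta)) (- (r + beta)^-1) ((k - r) / (N * (r + beta))).

Lemma least_proj_idem : least_proj *m least_proj = least_proj.
Proof.
by rewrite adj_comb_mul; congr adj_comb; field; rewrite ?N_neq0 ?rb_neq0.
Qed.

Lemma eigenspace_least_proj : (eigenspace A (- beta) == least_proj)%MS.
Proof.
apply/andP; split.
  set K := eigenspace _ _; have KA : K *m A = (- beta) *: K by exact/eigenspaceP.
  have KJ : K *m J = 0.
    apply/eqP; move: (congr1 (mulmx^~ J) KA); rewrite -mulmxA AJ -scalemxAl.
    move/eqP; rewrite -scalemxAr -subr_eq0 -scalerBl opprK scaler_eq0.
    by rewrite (negPf kb_neq0).
  rewrite (_ : K = K *m least_proj) ?submxMl // /least_proj /adj_comb.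
  rewrite !mulmxDr -!scalemxAr KA KJ mul_mx_scalar scaler0 addr0 scalerA -scalerDl.
  by rewrite -[LHS]scale1r; congr (_ *: _); field.
apply/eigenspaceP.
have AE : A = adj_comb 0 1 0.
  by rewrite /adj_comb scale1r scale0r addr0 -scalemx1 scale0r add0r.
rewrite [X in _ *m X]AE adj_comb_mul /least_proj /adj_comb.
rewrite !scalerDr !scalerA scale_scalar_mx.
by congr (_%:M + _ *: _ + _ *: _); field; rewrite ?N_neq0 ?rb_neq0.
Qed.

Section GramMatrix.
Variable mu : R.
Hypotheses (mu_beta : mu * (2 * beta - 1) = 1) (mu_gt0 : 0 < mu).
Hypothesis N_lt : N < 2 * (k + beta).

(** The matrix I + mu A - mu B, with B eliminated through B = J - I - A. *)
Definition srg_gram : 'M[R]_n := adj_comb (1 + mu) (2 * mu) (- mu).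

Let b_neq0 : 2 * beta - 1 != 0.
Proof. by apply: contra_eq_neq mu_beta => ->; rewrite mulr0 eq_sym oner_neq0. Qed.

Let muE : mu = (2 * beta - 1)^-1.
Proof. by apply: (mulIf b_neq0); rewrite mu_beta mulVf. Qed.

Lemma least_proj_gram : least_proj *m srg_gram = 0.
Proof.
rewrite adj_comb_mul -adj_comb0 muE.
by congr adj_comb; field; rewrite ?N_neq0 ?rb_neq0 ?b_neq0.
Qed.

Lemma srg_gram_sym : srg_gram^T = srg_gram.
Proof. exact: adj_comb_sym. Qed.

Lemma rank_srg_gram : (\rank least_proj + \rank srg_gram = n)%N.
Proof.
have l_neq0 : 2 * (k + beta) - N != 0 by rewrite gt_eqF // subr_gt0.
(* On the eigenspace of A for r and on the constants srg_gram acts by nonzero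
   scalars, which Y inverts there. *)
pose w := (2 * beta - 1) / (2 * (r + beta) ^+ 2).
pose Y := adj_comb (beta * w) w (- ((k + beta) / N) * w +
  (2 * beta - 1) / ((2 * (k + beta) - N) * N)).
have GY : srg_gram *m Y + least_proj = 1%:M.
  rewrite adj_comb_mul /least_proj /w muE.
  rewrite (_ : 1%:M = adj_comb 1 0 0); last by rewrite /adj_comb !scale0r !addr0.
  rewrite /adj_comb addrACA [X in X + _]addrACA -!scalerDl -raddfD /=.
  by congr (_%:M + _ *: _ + _ *: _); field;
     rewrite ?N_neq0 ?rb_neq0 ?b_neq0 ?l_neq0.
have sK : (kermx srg_gram <= least_proj)%MS.
  rewrite -[kermx _]mulmx1 -GY mulmxDr mulmxA mulmx_ker mul0mx add0r.
  exact: submxMl.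
have /eqP -> : \rank least_proj == \rank (kermx srg_gram).
  rewrite eq_sym (mxrank_leqif_sup sK); apply/sub_kermxP.
  exact: least_proj_gram.
by rewrite mxrank_ker subnK // rank_leq_row.
Qed.

(** V is A + beta cut down to the orthogonal complement of the constants, where
    it is r + beta times a projector; G is a nonnegative combination of V and
    J. *)
Lemma srg_gram_psd : psd srg_gram.
Proof.
pose V := adj_comb beta 1 (- ((k + beta) / N)).
have VV : V^T *m V = (r + beta) *: V.
  rewrite adj_comb_sym adj_comb_mul /V /adj_comb !scalerDr !scalerA.
  by rewrite scale_scalar_mx; congr (_%:M + _ *: _ + _ *: _); field.
have JJ : J^T *m J = N *: J by rewrite trmx_const const1_mul.
have -> : srg_gram = (2 * mu / (r + beta)) *: (V^T *m V) +
                     (mu * (2 * (k + beta) - N) / (N * N)) *: (J^T *m J).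
  rewrite VV JJ /srg_gram /V /adj_comb muE; apply/matrixP => i j; rewrite !mxE.
  by case: (i == j) => /=; field; rewrite ?N_neq0 ?rb_neq0 ?b_neq0.
have sq (Z : 'M[R]_n) (x : 'cV[R]_n) : 0 <= (x^T *m (Z^T *m Z) *m x) ord0 ord0.
  rewrite mulmxA -trmx_mul -mulmxA mxE; apply: sumr_ge0 => i _.
  by rewrite mxE -expr2 sqr_ge0.
have N0 : 0 < N by rewrite ltr0n.
move=> x; rewrite mulmxDr mulmxDl -!scalemxAr -!scalemxAl mxE addr_ge0 //.
  by rewrite mxE mulr_ge0 // divr_ge0 ?mulr_ge0 ?ltW.
by rewrite mxE mulr_ge0 // divr_ge0 ?mulr_ge0 ?subr_ge0 ?ltW.
Qed.

End GramMatrix.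

End AdjacencyAlgebra.

(** * Strongly regular graphs *)

Section StronglyRegular.
Variables (R : realType) (v k : nat) (e : rel 'I_v).
Hypothesis srg_e : strongly_regular k e.

Lemma srg_sym : symmetric e. Proof. by have [[]] := srg_e. Qed.

Lemma srg_irr : irreflexive e. Proof. by have [[]] := srg_e. Qed.

Lemma srg_card x : #|[set y | e x y]| = k.
Proof. by have [_ reg _] := srg_e; exact: reg. Qed.

(** Without common neighbours the closed neighbourhoods of x and y are
    disjoint. *)
Lemma srg_disjoint_neighborhoods x y :
  x != y -> ~~ e x y -> #|common_neighbors e x y| = 0%N -> (2 * k.+1 <= v)%N.
Proof.
move=> xy nexy /eqP; rewrite cards_eq0 => /eqP cn0.
pose N z := z |: [set t | e z t].
have cardN z : #|N z| = k.+1 by rewrite cardsU1 srg_card inE srg_irr.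
have N0 : N x :&: N y = finset.set0.
  apply/setP => z; rewrite !inE.
  have := finset.in_set0 z; rewrite -cn0 inE.
  have [->|zx] := eqVneq z x; first by rewrite (negPf xy) srg_sym (negPf nexy).
  by have [->|zy] := eqVneq z y; rewrite ?(negPf nexy).
have := cardsUI (N x) (N y); rewrite N0 cards0 addn0 !cardN addnn -mul2n => <-.
by rewrite -[leqRHS]card_ord max_card.
Qed.

(** Both bounds count common neighbours inside a neighbourhood, which for
    adjacent pairs also contains the other endpoint.  When the graph is complete
    the constant for non-adjacent pairs is unconstrained, and 0 is chosen. *)
Lemma srg_parameters : (exists x y, e x y) ->
  exists a c : nat, [/\ forall x y, e x y -> #|common_neighbors e x y| = a,
    forall x y, x != y -> ~~ e x y -> #|common_neighbors e x y| = c,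
    (a < k)%N & (c <= k)%N].
Proof.
have [_ _ [a [c [ea ec]]]] := srg_e; move=> [x0 [y0 exy0]].
have neq x y : e x y -> x != y by apply: contraTneq => ->; rewrite srg_irr.
have ak : (a < k)%N.
  rewrite -(ea _ _ (neq _ _ exy0) exy0) -(srg_card x0); apply: proper_card.
  apply/fintype.properP; split.
    by apply/fintype.subsetP => z; rewrite !inE => /andP[].
  by exists y0; rewrite !inE ?exy0 // srg_irr.
have [/existsP[x /existsP[y /andP[xy nexy]]]|none] :=
    boolP [exists x, exists y, (x != y) && ~~ e x y].
  exists a, c; split=> // [? ? h|]; first exact: ea (neq _ _ h) h.
  rewrite -(ec _ _ xy nexy) -(srg_card x); apply: subset_leq_card.
  by apply/fintype.subsetP => z; rewrite !inE => /andP[].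
exists a, 0%N; split=> // [? ? h|x y xy nexy]; first exact: ea (neq _ _ h) h.
by case/negP: none; apply/existsP; exists x; apply/existsP; exists y; apply/andP.
Qed.

Let A := adjacency_mx R e.

Lemma adjacency_sym : A^T = A.
Proof. by apply/matrixP => x y; rewrite !mxE srg_sym. Qed.

Lemma sum_pred_card (p : pred 'I_v) :
  \sum_z (p z)%:R = #|[set z | p z]|%:R :> R.
Proof.
rewrite -sum1_card natr_sum [RHS]big_mkcond /=.
by apply: eq_bigr => z _; rewrite inE; case: (p z).
Qed.

Lemma adjacency_const1 : A *m const_mx 1 = k%:R *: const_mx 1 :> 'M[R]_v.
Proof.
apply/matrixP => x y; rewrite !mxE mulr1 -(srg_card x) -sum_pred_card.
by apply: eq_bigr => z _; rewrite !mxE mulr1.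
Qed.

Lemma adjacency_sqr a c :
    (forall x y, e x y -> #|common_neighbors e x y| = a) ->
    (forall x y, x != y -> ~~ e x y -> #|common_neighbors e x y| = c) ->
  A *m A = (k%:R - c%:R)%:M + (a%:R - c%:R) *: A + c%:R *: const_mx 1.
Proof.
move=> ea ec; apply/matrixP => x y.
have -> : (A *m A) x y = #|common_neighbors e x y|%:R.
  rewrite mxE -sum_pred_card; apply: eq_bigr => z _.
  by rewrite !mxE -natrM mulnb (srg_sym z).
rewrite !mxE; have [<-|xy] := eqVneq x y.
  rewrite srg_irr (_ : common_neighbors e x x = [set z | e x z]).
    by rewrite srg_card /=; ring.
  by apply/setP => z; rewrite !inE andbb.
by case: (boolP (e x y)) => exy; rewrite ?(ea _ _ exy) ?(ec _ _ xy exy) /=; ring.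
Qed.

Lemma edge_of_eigenvalue beta :
  eigenvalue A (- beta) -> 0 < beta -> exists x y, e x y.
Proof.
case/eigenvalueP=> u uA u0 b0; apply: contrapT => none.
have A0 : A = 0.
  apply/matrixP => x y; rewrite !mxE; case: (boolP (e x y)) => // exy.
  by case: none; exists x, y.
move/eqP: uA; rewrite A0 mulmx0 eq_sym scaler_eq0 oppr_eq0 (negPf u0) orbF.
by rewrite gt_eqF.
Qed.

(** The identity A^2 = (k - c) I + (a - c) A + c J makes - beta and
    r = a - c + beta the two roots of a quadratic equation, so r beta = k - c,
    which is nonnegative.  The bound 1 <= beta follows from
    (1 + r) (beta - 1) = k - a - 1.  If k <= r then k <= r beta = k - c, so that
    c = 0 and beta = 1; a non-adjacent pair then yields two disjoint closed
    neighbourhoods, hence 2 (k + 1) <= v, against v < 2 (k + beta). *)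
Lemma srg_eigenvalue beta :
    eigenvalue A (- beta) -> 0 < beta -> v%:R < 2 * (k%:R + beta) ->
  exists r : R, [/\ 0 <= r, 1 <= beta,
    forall x y, x != y -> ~~ e x y -> r < k%:R &
    A *m A = (r * beta)%:M + (r - beta) *: A +
      ((k%:R - r) * (k%:R + beta) / v%:R) *: const_mx 1].
Proof.
move=> eig b0 vlt; have edge := edge_of_eigenvalue eig b0.
have [a [c [ea ec ak ck]]] := srg_parameters edge.
have AA := adjacency_sqr ea ec; have [x0 _] := edge.
have v0 : v%:R != 0 :> R by rewrite pnatr_eq0 -lt0n (leq_ltn_trans _ (ltn_ord x0)).
have ak' : a%:R + 1 <= k%:R :> R by rewrite natr1 ler_nat.
have ck' : c%:R <= k%:R :> R by rewrite ler_nat.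
have a0 : 0 <= a%:R :> R by [].
have c0 : 0 <= c%:R :> R by [].
have cv : c%:R * v%:R = k%:R ^+ 2 - (k%:R - c%:R) - (a%:R - c%:R) * k%:R :> R.
  have := congr1 (fun M : 'M[R]_v => (M *m const_mx 1) x0 x0) AA.
  rewrite -mulmxA !mulmxDl -!scalemxAl const1_mul mul_scalar_mx adjacency_const1.
  rewrite -scalemxAr adjacency_const1 !mxE !mulr1 => kk.
  by rewrite expr2; lra.
have bb : beta ^+ 2 = (k%:R - c%:R) - (a%:R - c%:R) * beta.
  have /eigenvalueP[u uA u0] := eig.
  have uJ : u *m (const_mx 1 : 'M[R]_v) = 0.
    move: (congr1 (mulmx^~ (const_mx 1 : 'M[R]_v)) uA).
    rewrite -mulmxA adjacency_const1 -scalemxAl -scalemxAr => /eqP.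
    by rewrite -subr_eq0 -scalerBl opprK scaler_eq0 gt_eqF => [/eqP|]; last lra.
  move: (congr1 (mulmx u) AA); rewrite mulmxA uA -scalemxAl uA !mulmxDr.
  rewrite -!scalemxAr uJ uA mul_mx_scalar scaler0 addr0 !scalerA -scalerDl.
  move/eqP; rewrite -subr_eq0 -scalerBl scaler_eq0 (negPf u0) orbF => /eqP; lra.
pose r : R := a%:R - c%:R + beta.
have rb : r * beta = k%:R - c%:R by rewrite /r mulrDl -expr2 bb; ring.
have r0 : 0 <= r by rewrite -(pmulr_lge0 _ b0) rb; lra.
have b1 : 1 <= beta.
  have : 0 <= (1 + r) * (beta - 1).
    by rewrite mulrBr mulr1 mulrDl mul1r rb /r; lra.
  by rewrite pmulr_rge0; lra.
exists r; split=> // [x y xy nexy|].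
  rewrite ltNge; apply/negP => kr.
  have rrb : r <= r * beta by rewrite ler_peMr.
  have cE : c = 0%N by apply/eqP; rewrite -(pnatr_eq0 R); apply/eqP; lra.
  have k0 : 0 < k%:R :> R by lra.
  have b1' : beta = 1.
    apply/eqP; rewrite eq_le b1 andbT -(ler_pM2l k0) mulr1.
    by apply: le_trans (ler_wpM2r (ltW b0) kr) _; lra.
  have := srg_disjoint_neighborhoods xy nexy (etrans (ec _ _ xy nexy) cE).
  by rewrite -(ler_nat R) natrM -natr1; lra.
have -> : (k%:R - r) * (k%:R + beta) / v%:R = c%:R.
  apply: (mulIf v0); rewrite divfK // cv.
  rewrite [LHS](_ : _ = k%:R ^+ 2 - (r - beta) * k%:R - r * beta); last ring.
  by rewrite rb /r; ring.
by rewrite AA rb /r addrK.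
Qed.

End StronglyRegular.

Theorem corollary14 (R : realType) (v k m d : nat) (e : rel 'I_v)
    (A B : 'M[R]_v) (beta mu : R)
    (srg_e : strongly_regular k e)
    (A_def : A = adjacency_mx R e)
    (B_def : B = adjacency_mx R (graph_compl e))
    (beta_eig : smallest_eigenvalue A (- beta))
    (beta_neg : - beta < 0)
    (m_def : m = eigenvalue_mult A (- beta))
    (v_neq : (2 * k + 1)%N <> v)
    (v_lt : v%:R < 2 * (k%:R + beta))
    (d_def : d = (v - m)%N)
    (mu_def : mu = 1 / (2 * beta - 1)) :
  exists Phi : 'M[R]_(d, v),
    gram Phi = 1%:M + mu *: A - mu *: B /\ strongly_locally_optimal Phi.
Proof.
have b0 : 0 < beta by rewrite -oppr_lt0.
have eig : eigenvalue (adjacency_mx R e) (- beta).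
  by rewrite -A_def; case: beta_eig.
have [r [r0 b1 rk AA]] := srg_eigenvalue srg_e eig b0 v_lt.
have [x0 _] := edge_of_eigenvalue eig b0.
have v0 : (0 < v)%N by exact: leq_ltn_trans (ltn_ord x0).
have kv : k%:R < v%:R :> R.
  rewrite ltr_nat -(srg_card srg_e x0) -[ltnRHS]card_ord -cardsT.
  apply: proper_card; apply/fintype.properP.
  split; first by apply/fintype.subsetP => z _; rewrite inE.
  by exists x0; rewrite !inE // (srg_irr srg_e).
rewrite -A_def in AA; have Asym := adjacency_sym R srg_e.
have AJ := adjacency_const1 R srg_e; rewrite -A_def in Asym AJ.
have k0 : 0 <= k%:R :> R by [].
have rb0 : 0 < r + beta by lra.
have kb0 : 0 < k%:R + beta by lra.
have mub : mu * (2 * beta - 1) = 1.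
  by rewrite mu_def mul1r mulVf // gt_eqF //; lra.
have mu0 : 0 < mu by rewrite mu_def divr_gt0 //; lra.
set G := 1%:M + mu *: A - mu *: B.
have GE : G = srg_gram A mu.
  apply/matrixP => i j; rewrite /G A_def B_def !mxE /graph_compl /=.
  have [<-|ij] := eqVneq i j; first by rewrite (srg_irr srg_e) /=; ring.
  by case: (e i j) => /=; ring.
pose P := least_proj A k%:R r beta.
have rP : \rank P = m.
  by have /eqmxP <- := eigenspace_least_proj v0 Asym AJ AA rb0 kb0; rewrite m_def.
have rank_PG : (\rank P + \rank G = v)%N.
  by rewrite GE; apply: (rank_srg_gram v0 Asym AJ AA rb0).
have rG : \rank G = d.
  by rewrite d_def -rP -[in LHS](addKn (\rank P) (\rank G)) rank_PG.
have Gsym : G^T = G by rewrite GE srg_gram_sym.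
have Gpsd : psd G by rewrite GE; apply: (srg_gram_psd v0 Asym AJ AA rb0).
have G_off i j : i != j -> G i j = if e i j then mu else - mu.
  move=> ij; rewrite /G A_def B_def !mxE /graph_compl /= ij (negPf ij).
  by case: (e i j) => /=; ring.
have G_diag i : G i i = 1.
  by rewrite /G A_def B_def !mxE /graph_compl /= eqxx (srg_irr srg_e) /=; ring.
have [Phi PhiE] := psd_gram_factor Gsym Gpsd (eq_leq rG).
exists Phi; split=> //; split.
  move=> j; rewrite -(G_diag j) -PhiE mxE; apply: eq_bigr => i _.
  by rewrite mxE expr2.
rewrite PhiE; apply: (@projector_sign_strong_local_minimizer R d v mu G P) => //.
- exact: adj_comb_sym.
- exact: least_proj_idem.
- by rewrite GE; apply: least_proj_gram.
- by rewrite rP d_def -rP subnKC // rank_leq_row.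
- exact: ltW.
have vR0 : 0 < v%:R :> R by rewrite ltr0n.
move=> i j ij; rewrite G_off //.
have -> : P i j = (r + beta)^-1 * ((k%:R - r) / v%:R - (e i j)%:R).
  rewrite /P /least_proj /adj_comb A_def !mxE (negPf ij) invfM /= mulr0n; ring.
case: (boolP (e i j)) => eij; [left|right]; split=> //.
  by rewrite pmulr_rlt0 ?invr_gt0 // subr_lt0 ltr_pdivrMr // mul1r; lra.
by rewrite pmulr_rgt0 ?invr_gt0 // subr0 divr_gt0 // subr_gt0 (rk _ _ ij eij).
Qed.
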